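(* Let $0<q<1$. The functional $\varphi=\varphi_1+\varphi_2$ on $\mathcal A(\mathbb CP^2_q)^{\otimes5}$, where $$\varphi_1(a_0,\dots,a_4)=-3\int_h a_0\,\partial a_1\,\partial a_2\,\bar\partial a_3\,\bar\partial a_4,\qquad \varphi_2(a_0,\dots,a_4)=-3\int_h a_0\,\bar\partial a_1\,\bar\partial a_2\,\partial a_3\,\partial a_4,$$ is a twisted positive Hochschild 4-cocycle on $\mathcal A(\mathbb CP^2_q)$, with respect to the automorphism $\sigma(x)=K\triangleright x$, $K=(K_1K_2)^{-4}$.
   Context: Fix $0<q<1$. $U_q(\mathfrak{su}(3))$ is the Hopf $*$-algebra generated by $K_i^{\pm1},E_i,F_i$ ($i=1,2$), $K_i^*=K_i$, $E_i^*=F_i$, with $[K_1,K_2]=0$, $K_iE_i=qE_iK_i$, $[E_i,F_i]=\frac{K_i^2-K_i^{-2}}{q-q^{-1}}$, and for $i\ne j$: $K_iE_j=q^{-1/2}E_jK_i$, $[E_i,F_j]=0$, $E_i^2E_j+E_jE_i^2=(q+q^{-1})E_iE_jE_i$; $\Delta(K_i)=K_i\otimes K_i$, $\Delta(E_i)=E_i\otimes K_i+K_i^{-1}\otimes E_i$, $\Delta(F_i)=F_i\otimes K_i+K_i^{-1}\otimes F_i$; $\epsilon(K_i)=1$, $\epsilon(E_i)=\epsilon(F_i)=0$; $S(K_i)=K_i^{-1}$, $S(E_i)=-qE_i$, $S(F_i)=-q^{-1}F_i$. $\mathcal A(SU_q(3))$ is the Hopf $*$-algebra generated by $u^i_j$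 ($i,j=1,2,3$) with $u^i_ku^j_k=qu^j_ku^i_k$ and $u^k_iu^k_j=qu^k_ju^k_i$ for $i<j$; $[u^i_l,u^j_k]=0$ and $[u^i_k,u^j_l]=(q-q^{-1})u^i_lu^j_k$ for $i<j$, $k<l$; $\sum_{\pi\in S_3}(-q)^{\ell(\pi)}u^1_{\pi(1)}u^2_{\pi(2)}u^3_{\pi(3)}=1$; $(u^i_j)^*=(-q)^{j-i}(u^{k_1}_{l_1}u^{k_2}_{l_2}-qu^{k_1}_{l_2}u^{k_2}_{l_1})$, where $\{k_1<k_2\}=\{1,2,3\}\setminus\{i\}$, $\{l_1<l_2\}=\{1,2,3\}\setminus\{j\}$; $\Delta(u^i_j)=\sum_ku^i_k\otimes u^k_j$. It carries commuting left and right actions of $U_q(\mathfrak{su}(3))$ with $h\triangleright(ab)=(h_{(1)}\triangleright a)(h_{(2)}\triangleright b)$, $(ab)\triangleleft h=(a\triangleleft h_{(1)})(b\triangleleft h_{(2)})$, $(h\triangleright a)^*=S(h)^*\triangleright a^*$, $(a\triangleleft h)^*=a^*\triangleleft S(h)^*$, units acted on through $\epsilon$, and $K_i\triangleright u^j_k=q^{\frac12(\delta_{i+1,k}-\delta_{i,k})}u^j_k$, $E_i\triangleright u^j_k=\delta_{i,k}u^j_{i+1}$, $F_i\triangleright u^j_k=\delta_{i+1,k}u^j_i$, $u^j_k\triangleleft K_i=q^{\frac12(\delta_{i+1,j}-\delta_{i,j})}u^j_k$, $u^j_k\triangleleft E_i=\delta_{i+1,j}u^i_k$, $u^j_k\triangleleft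 F_i=\delta_{i,j}u^{i+1}_k$. $\mathcal A(S^5_q)=\{a: a\triangleleft h=\epsilon(h)a$ for $h$ in the subalgebra generated by $K_1^{\pm1},E_1,F_1\}$; $\mathcal L_N=\{a\in\mathcal A(S^5_q):a\triangleleft K_1K_2^2=q^Na\}$ for $N\in\mathbb Z$; $\mathcal A:=\mathcal A(\mathbb CP^2_q)=\mathcal L_0$. Calculus. $\Omega^{(1,0)}$ (resp. $\Omega^{(0,1)}$) is the $\mathcal A$-bimodule (componentwise multiplication) of pairs $(v_+,v_-)\in\mathcal A(SU_q(3))^2$ with $(v_+,v_-)\triangleleft K_1=(q^{1/2}v_+,q^{-1/2}v_-)$, $(v_+,v_-)\triangleleft F_1=(0,v_+)$, $(v_+,v_-)\triangleleft E_1=(v_-,0)$, and $(v_+,v_-)\triangleleft K_1K_2^2=q^{-3/2}(v_+,v_-)$ (resp. $q^{3/2}(v_+,v_-)$). Up to multiplicative constants, $\partial a=(a\triangleleft E_2,\ a\triangleleft E_2E_1)$, $\bar\partial a=(a\triangleleft F_2F_1,\ a\triangleleft F_2)$, and $\mathrm d=\partial+\bar\partial$. The differential $*$-calculus $\Omega^\bullet=\bigoplus\Omega^{(p,q)}$ ($0\le p,q\le2$) is generated by $\Omega^1=\Omega^{(1,0)}\oplus\Omega^{(0,1)}$; it is the maximal prolongation, i.e. the quotient of the tensor algebra $T_{\mathcal A}(\Omega^1)$ by the ideal generated by all $\sum_i\mathrm da_i\otimes\mathrm db_i$ with $\sum_ia_i\,\mathrm db_i=0$. The maps $\partial,\bar\partial$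 have bidegree $(1,0)$, $(0,1)$, satisfy the graded Leibniz rule, $\partial^2=\bar\partial^2=\partial\bar\partial+\bar\partial\partial=0$, and $\partial(a^* )=-(\bar\partial a)^*$, with $(\alpha\beta)^*=(-1)^{\deg\alpha\deg\beta}\beta^*\alpha^*$. One has $\Omega^{(2,0)}\simeq\mathcal L_{-3}$, $\Omega^{(0,2)}\simeq\mathcal L_3$, the products $\Omega^{(1,0)}\times\Omega^{(1,0)}\to\Omega^{(2,0)}$ and $\Omega^{(0,1)}\times\Omega^{(0,1)}\to\Omega^{(0,2)}$ both being, up to normalization, $v\wedge w=q^{1/2}v_+w_--q^{-1/2}v_-w_+$. $\Omega^{(2,2)}$ is a free rank-one $\mathcal A$-module with a basis element $\omega$ that is central ($\omega a=a\omega$), normalized so that, in terms of the explicit formulas above for $\partial a,\bar\partial a,\wedge$ and the product of $\mathcal A(SU_q(3))$, $\partial a_1\partial a_2\bar\partial a_3\bar\partial a_4=\kappa_1\,(\partial a_1\wedge\partial a_2)(\bar\partial a_3\wedge\bar\partial a_4)\,\omega$ and $\bar\partial a_1\bar\partial a_2\partial a_3\partial a_4=\kappa_2\,(\bar\partial a_1\wedge\bar\partial a_2)(\partial a_3\wedge\partial a_4)\,\omega$ with real constants $\kappa_1,\kappa_2>0$. Integral. $h$ is the Haar state of $\mathcal A(SU_q(3))$ (the unique invariant state, faithful), satisfying $h(xy)=h(\sigma(y)x)$ for $\sigma(x)=K\triangleright x\triangleleft K$, $K=(K_1K_2)^{-4}$; on $\mathcal A$, $\sigma(x)=K\triangleright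 x$. Define $\int_h x\omega=h(x)$ for $x\in\mathcal A$. Twisted Hochschild cohomology. $C^n_\sigma(\mathcal A)=\ker(1-\lambda_\sigma^{n+1})\subset\mathrm{Hom}(\mathcal A^{\otimes(n+1)},\mathbb C)$, where $(\lambda_\sigma\phi)(a_0,\dots,a_n)=(-1)^n\phi(\sigma(a_n),a_0,\dots,a_{n-1})$; $b_\sigma\phi(a_0,\dots,a_{n+1})=\sum_{i=0}^n(-1)^i\phi(a_0,\dots,a_ia_{i+1},\dots,a_{n+1})+(-1)^{n+1}\phi(\sigma(a_{n+1})a_0,\dots,a_n)$. A twisted Hochschild $n$-cocycle is $\phi\in C^n_\sigma(\mathcal A)$ with $b_\sigma\phi=0$. A twisted Hochschild $2n$-cocycle $\phi$ is twisted positive if $\langle a_0\otimes\cdots\otimes a_n,\,b_0\otimes\cdots\otimes b_n\rangle=\phi(\sigma(b_0^* )a_0,a_1,\dots,a_n,b_n^*,\dots,b_1^* )$ defines a positive sesquilinear form on $\mathcal A^{\otimes(n+1)}$. *)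

(* Defs.v *)
From HB Require Import structures.
From mathcomp Require Import all_boot all_order all_algebra perm.
From mathcomp Require Import boolp classical_sets.

Set Implicit Arguments.
Unset Strict Implicit.
Unset Printing Implicit Defensive.

Import Order.TTheory GRing.Theory Num.Theory.
Local Open Scope ring_scope.

Section Tensors.
Variable C : numClosedFieldType.

Definition multilinear (A V : lmodType C) n (f : n.-tuple A -> V) : Prop :=
  forall (t : n.-tuple A) (i : 'I_n),
    linear (fun x => f [tuple if j == i then x else t`_j | j < n]).

(* Elements of the n-th tensor power of A over C are written as finite formal
   sums (sequences) of elementary tensors; two such sums are the same tensor
   iff every multilinear map takes the same value on both. *)
Definition tensor_eq (A : lmodType C) n (s t : seq (n.-tuple A)) : Prop :=
  forall (V : lmodType C) (f : n.-tuple A -> V), multilinear f ->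
    \sum_(x <- s) f x = \sum_(x <- t) f x.

Inductive gen_subalgebra (A : algType C) (S : A -> Prop) : A -> Prop :=
| gen_in x of S x : gen_subalgebra S x
| gen_one : gen_subalgebra S 1
| gen_linear (c : C) x y of gen_subalgebra S x & gen_subalgebra S y :
    gen_subalgebra S (c *: x + y)
| gen_mul x y of gen_subalgebra S x & gen_subalgebra S y :
    gen_subalgebra S (x * y).

End Tensors.

HB.mixin Record isStarAlgebra (C : numClosedFieldType) A
    of GRing.Algebra C A := {
  star : A -> A;
  starK : involutive star;
  star_linear : forall (c : C) x y, star (c *: x + y) = c^* *: star x + star y;
  starM : forall x y, star (x * y) = star y * star x
}.

#[short(type="starAlgType")]
HB.structure Definition StarAlgebra (C : numClosedFieldType) :=
  {A of isStarAlgebra C A & GRing.Algebra C A}.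

Section Hopf.
Variable C : numClosedFieldType.

Definition star_morphism (A B : starAlgType C) (f : A -> B) : Prop :=
  forall x, f (star x) = star (f x).

(* In Sweedler notation, the sum over p <- comul x ranges over the terms
   x_(1) = p`_0, x_(2) = p`_1. Only the class of comul x for tensor_eq is
   meaningful. *)
Record hopf_star (H : starAlgType C) := HopfStar {
  comul : H -> seq (2.-tuple H);
  counit : {lrmorphism H -> C^o};
  antipode : {linear H -> H};
  comul_linear : forall (c : C) x y, tensor_eq (comul (c *: x + y))
    ([seq [tuple c *: p`_0; p`_1] | p : 2.-tuple H <- comul x] ++ comul y);
  comul_one : tensor_eq (comul 1) [:: [tuple 1; 1]];
  comul_mul : forall x y, tensor_eq (comul (x * y))
    [seq [tuple p`_0 * r`_0; p`_1 * r`_1]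
       | p : 2.-tuple H <- comul x, r : 2.-tuple H <- comul y];
  comul_star : forall x, tensor_eq (comul (star x))
    [seq [tuple star p`_0; star p`_1] | p : 2.-tuple H <- comul x];
  comul_assoc : forall x, tensor_eq
    [seq [tuple r`_0; r`_1; p`_1]
       | p : 2.-tuple H <- comul x, r : 2.-tuple H <- comul p`_0]
    [seq [tuple p`_0; r`_0; r`_1]
       | p : 2.-tuple H <- comul x, r : 2.-tuple H <- comul p`_1];
  counit_left : forall x, \sum_(p <- comul x) counit p`_0 *: p`_1 = x;
  counit_right : forall x, \sum_(p <- comul x) counit p`_1 *: p`_0 = x;
  counit_star : forall x, counit (star x) = (counit x : C)^*;
  antipode_left : forall x,
    \sum_(p <- comul x) antipode p`_0 * p`_1 = counit x *: 1;
  antipode_right : forall x,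
    \sum_(p <- comul x) p`_0 * antipode p`_1 = counit x *: 1
}.

End Hopf.

Section TwistedHochschild.
Variables (C : numClosedFieldType) (A : starAlgType C) (sigma : A -> A).
Local Notation functional n := (n.-tuple A -> C^o).

Definition cyclic_op n (phi : functional n.+1) : functional n.+1 :=
  fun a => (-1) ^+ n *
    phi [tuple if j == 0%N :> nat then sigma a`_n else a`_j.-1 | j < n.+1].

Definition hochschild_cochain n (phi : functional n.+1) : Prop :=
  multilinear phi /\ forall a, iter n.+1 (@cyclic_op n) phi a = phi a.

Definition hochschild_b n (phi : functional n.+1) : functional n.+2 :=
  fun a =>
    \sum_(i < n.+1) (-1) ^+ i *
      phi [tuple if (j < i)%N then a`_j
                 else if j == i then a`_i * a`_i.+1 else a`_j.+1 | j < n.+1]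
    + (-1) ^+ n.+1 *
      phi [tuple if j == 0%N :> nat then sigma a`_n.+1 * a`_0 else a`_j
                 | j < n.+1].

Definition hochschild_cocycle n (phi : functional n.+1) : Prop :=
  hochschild_cochain phi /\ forall a, hochschild_b phi a = 0.

Definition twisted_form n (phi : functional n.*2.+1) (a b : n.+1.-tuple A) : C :=
  phi [tuple if j == 0%N :> nat then sigma (star b`_0) * a`_0
             else if (j <= n)%N then a`_j
             else star b`_(n.*2.+1 - j) | j < n.*2.+1].

(* The form is extended from elementary tensors to sums of these; the scalar
   coefficients can be absorbed in the elementary tensors. *)
Definition twisted_positive n (phi : functional n.*2.+1) : Prop :=
  forall s : seq (n.+1.-tuple A),
    0 <= \sum_(a <- s) \sum_(b <- s) twisted_form phi a b.

Definition twisted_positive_cocycle n (phi : functional n.*2.+1) : Prop :=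
  hochschild_cocycle phi /\ twisted_positive phi.

End TwistedHochschild.

(* q^{k/2} *)
Definition qpow (C : numClosedFieldType) (q : C) (k : int) : C := sqrtC q ^ k.

(* Indices are shifted by one: i : 'I_2 stands for i+1 in {1,2}, and lo i, hi i
   are then the indices i, i+1 of {1,2,3}. *)
Definition lo (i : 'I_2) : 'I_3 := widen_ord (leqnSn 2) i.
Definition hi (i : 'I_2) : 'I_3 := lift ord0 i.

Section QuantumGroups.
Variables (C : numClosedFieldType) (q : C).

Record Uq_su3_relations (B : starAlgType C) (K Kinv E F : 'I_2 -> B) : Prop := {
  rel_KKinv : forall i, K i * Kinv i = 1;
  rel_KinvK : forall i, Kinv i * K i = 1;
  rel_starK : forall i, star (K i) = K i;
  rel_starE : forall i, star (E i) = F i;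
  rel_KK : K 0 * K 1 = K 1 * K 0;
  rel_KE : forall i, K i * E i = q *: (E i * K i);
  rel_EF : forall i, E i * F i - F i * E i =
    (q - q^-1)^-1 *: (K i ^+ 2 - Kinv i ^+ 2);
  rel_KEne : forall i j, i != j -> K i * E j = qpow q (-1) *: (E j * K i);
  rel_EFne : forall i j, i != j -> E i * F j - F j * E i = 0;
  rel_Serre : forall i j, i != j ->
    E i ^+ 2 * E j + E j * E i ^+ 2 = (q + q^-1) *: (E i * E j * E i)
}.

Definition perm_length (s : 'S_3) : nat :=
  #|[set p : 'I_3 * 'I_3 | (p.1 < p.2)%N && (s p.2 < s p.1)%N]|.

(* u i j is u^i_j. For i : 'I_3, lift i 0 < lift i 1 are the other indices. *)
Record SUq3_relations (B : starAlgType C) (u : 'I_3 -> 'I_3 -> B) : Prop := {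
  rel_col : forall i j k : 'I_3, (i < j)%N ->
    u i k * u j k = q *: (u j k * u i k);
  rel_row : forall i j k : 'I_3, (i < j)%N ->
    u k i * u k j = q *: (u k j * u k i);
  rel_comm : forall i j k l : 'I_3, (i < j)%N -> (k < l)%N ->
    u i l * u j k - u j k * u i l = 0;
  rel_cross : forall i j k l : 'I_3, (i < j)%N -> (k < l)%N ->
    u i k * u j l - u j l * u i k = (q - q^-1) *: (u i l * u j k);
  rel_det : \sum_(s : 'S_3)
    (- q) ^+ perm_length s *: (u 0 (s 0) * u 1 (s 1) * u 2 (s 2)) = 1;
  rel_star : forall i j : 'I_3, star (u i j) = (- q) ^ (j%:Z - i%:Z) *:
    (u (lift i 0) (lift j 0) * u (lift i 1) (lift j 1)
     - q *: (u (lift i 0) (lift j 1) * u (lift i 1) (lift j 0)))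
}.

Record Uq_su3 (q01 : 0 < q < 1) := UqSu3 {
  Uq_alg :> starAlgType C;
  Uq_hopf : hopf_star Uq_alg;
  UK : 'I_2 -> Uq_alg;
  UKinv : 'I_2 -> Uq_alg;
  UE : 'I_2 -> Uq_alg;
  UF : 'I_2 -> Uq_alg;
  Uq_rel : Uq_su3_relations UK UKinv UE UF;
  Uq_universal : forall (B : starAlgType C) (K Kinv E F : 'I_2 -> B),
    Uq_su3_relations K Kinv E F ->
    let good (f : {lrmorphism Uq_alg -> B}) :=
      star_morphism f /\ forall i, [/\ f (UK i) = K i, f (UKinv i) = Kinv i,
                                       f (UE i) = E i & f (UF i) = F i] in
    exists f : {lrmorphism Uq_alg -> B},
      good f /\ forall g : {lrmorphism Uq_alg -> B}, good g -> g =1 f;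
  UcomulK : forall i,
    tensor_eq (comul Uq_hopf (UK i)) [:: [tuple UK i; UK i]];
  UcomulE : forall i, tensor_eq (comul Uq_hopf (UE i))
    [:: [tuple UE i; UK i]; [tuple UKinv i; UE i]];
  UcomulF : forall i, tensor_eq (comul Uq_hopf (UF i))
    [:: [tuple UF i; UK i]; [tuple UKinv i; UF i]];
  UcounitK : forall i, counit Uq_hopf (UK i) = 1;
  UcounitE : forall i, counit Uq_hopf (UE i) = 0;
  UcounitF : forall i, counit Uq_hopf (UF i) = 0;
  UantipodeK : forall i, antipode Uq_hopf (UK i) = UKinv i;
  UantipodeE : forall i, antipode Uq_hopf (UE i) = - q *: UE i;
  UantipodeF : forall i, antipode Uq_hopf (UF i) = - q^-1 *: UF i
}.

End QuantumGroups.

Section SUq3.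
Variables (C : numClosedFieldType) (q : C) (q01 : 0 < q < 1) (U : Uq_su3 q01).

Record SUq3 := SUq3Build {
  SUq3_alg :> starAlgType C;
  SUq3_hopf : hopf_star SUq3_alg;
  u : 'I_3 -> 'I_3 -> SUq3_alg;
  SUq3_rel : SUq3_relations q u;
  SUq3_universal : forall (B : starAlgType C) (v : 'I_3 -> 'I_3 -> B),
    SUq3_relations q v ->
    let good (f : {lrmorphism SUq3_alg -> B}) :=
      star_morphism f /\ forall i j, f (u i j) = v i j in
    exists f : {lrmorphism SUq3_alg -> B},
      good f /\ forall g : {lrmorphism SUq3_alg -> B}, good g -> g =1 f;
  comul_u : forall i j, tensor_eq (comul SUq3_hopf (u i j))
    [seq [tuple u i k; u k j] | k <- enum 'I_3];
  (* lact x a and ract a x are the left and right actions of x : U on a *)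
  lact : U -> SUq3_alg -> SUq3_alg;
  ract : SUq3_alg -> U -> SUq3_alg;
  lact_linear : forall x, linear (lact x);
  lact_linearl : forall a, linear (lact^~ a);
  ract_linear : forall a, linear (ract a);
  ract_linearl : forall x, linear (ract^~ x);
  lact1 : forall a, lact 1 a = a;
  ract1 : forall a, ract a 1 = a;
  lactM : forall x y a, lact (x * y) a = lact x (lact y a);
  ractM : forall x y a, ract a (x * y) = ract (ract a x) y;
  lract : forall x y a, ract (lact x a) y = lact x (ract a y);
  lact_mul : forall x a b, lact x (a * b) =
    \sum_(p <- comul (Uq_hopf U) x) lact p`_0 a * lact p`_1 b;
  ract_mul : forall x a b, ract (a * b) x =
    \sum_(p <- comul (Uq_hopf U) x) ract a p`_0 * ract b p`_1;
  lact_one : forall x, lact x 1 = counit (Uq_hopf U) x *: 1;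
  ract_one : forall x, ract 1 x = counit (Uq_hopf U) x *: 1;
  lact_star : forall x a,
    star (lact x a) = lact (star (antipode (Uq_hopf U) x)) (star a);
  ract_star : forall x a,
    star (ract a x) = ract (star a) (star (antipode (Uq_hopf U) x));
  lactK : forall i j k, lact (UK U i) (u j k) =
    qpow q ((hi i == k)%:Z - (lo i == k)%:Z) *: u j k;
  lactE : forall i j k, lact (UE U i) (u j k) =
    (lo i == k)%:R *: u j (hi i);
  lactF : forall i j k, lact (UF U i) (u j k) =
    (hi i == k)%:R *: u j (lo i);
  ractK : forall i j k, ract (u j k) (UK U i) =
    qpow q ((hi i == j)%:Z - (lo i == j)%:Z) *: u j k;
  ractE : forall i j k, ract (u j k) (UE U i) =
    (hi i == j)%:R *: u (lo i) k;
  ractF : forall i j k, ract (u j k) (UF U i) =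
    (lo i == j)%:R *: u (hi i) k
}.

End SUq3.

Section CP2.
Variables (C : numClosedFieldType) (q : C) (q01 : 0 < q < 1) (U : Uq_su3 q01).
Variable (A : SUq3 U).
Local Notation K1 := (UK U 0).
Local Notation K2 := (UK U 1).
Local Notation K1inv := (UKinv U 0).
Local Notation K2inv := (UKinv U 1).
Local Notation E1 := (UE U 0).
Local Notation E2 := (UE U 1).
Local Notation F1 := (UF U 0).
Local Notation F2 := (UF U 1).

Definition modular_elt : U := (K2inv * K1inv) ^+ 4.
Definition modular_aut (x : A) : A := ract (lact modular_elt x) modular_elt.

(* Conditions haar_one to haar_right already determine h; haar_faithful and
   haar_modular are known properties of the Haar state of A(SU_q(3)). *)
Record haar_state (h : {linear A -> C^o}) : Prop := {
  haar_one : h 1 = 1;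
  haar_ge0 : forall x, 0 <= (h (star x * x) : C);
  haar_left : forall x,
    \sum_(p <- comul (SUq3_hopf A) x) h p`_1 *: p`_0 = h x *: 1;
  haar_right : forall x,
    \sum_(p <- comul (SUq3_hopf A) x) h p`_0 *: p`_1 = h x *: 1;
  haar_faithful : forall x, h (star x * x) = 0 -> x = 0;
  haar_modular : forall x y, h (x * y) = h (modular_aut y * x)
}.

Definition Uq_su2 : U -> Prop :=
  gen_subalgebra (fun x => x \in [:: K1; K1inv; E1; F1]).

Definition in_S5 (a : A) : Prop :=
  forall x, Uq_su2 x -> ract a x = counit (Uq_hopf U) x *: a.

Definition in_L (N : int) (a : A) : Prop :=
  in_S5 a /\ ract a (K1 * K2 ^+ 2) = q ^ N *: a.

Definition CP2_pred : {pred A} := fun a => `[< in_L 0 a >].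

Record CP2 := CP2Build { CP2_val :> A; CP2_valP : CP2_pred CP2_val }.
HB.instance Definition _ := [isSub for CP2_val].
HB.instance Definition _ := [Choice of CP2 by <:].

Lemma ract_comul x a b (t : seq (2.-tuple U)) :
  tensor_eq (comul (Uq_hopf U) x) t ->
  ract (a * b : A) x = \sum_(p <- t) ract a p`_0 * ract b p`_1.
Proof.
rewrite ract_mul => /(_ A (fun p : 2.-tuple U => ract a p`_0 * ract b p`_1)).
apply=> p i c y z; rewrite /= !(enum_ordSl, enum_ord0) /=.
case: i => -[|[|//]] i_lt /=; rewrite ract_linear.
  by rewrite mulrDl -scalerAl.
by rewrite mulrDr -scalerAr.
Qed.

Lemma ractMK i a b : ract (a * b : A) (UK U i) = ract a (UK U i) * ract b (UK U i).
Proof. by rewrite (ract_comul _ _ (UcomulK i)) big_seq1. Qed.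

Lemma ractME i a b : ract (a * b : A) (UE U i) =
  ract a (UE U i) * ract b (UK U i) + ract a (UKinv U i) * ract b (UE U i).
Proof. by rewrite (ract_comul _ _ (UcomulE i)) big_cons big_seq1. Qed.

Lemma ractMF i a b : ract (a * b : A) (UF U i) =
  ract a (UF U i) * ract b (UK U i) + ract a (UKinv U i) * ract b (UF U i).
Proof. by rewrite (ract_comul _ _ (UcomulF i)) big_cons big_seq1. Qed.


Lemma ract0l x : ract (0 : A) x = 0.
Proof.
by have := ract_linearl x (-1) (0 : A) 0; rewrite scaler0 addr0 scaleN1r addNr.
Qed.

Lemma ractZ a c x : ract (a : A) (c *: x) = c *: ract a x.
Proof.
have ra0 : ract a 0 = 0.
  by have := ract_linear a (-1) 0 0; rewrite scaler0 addr0 scaleN1r addNr.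
by rewrite -[c *: x]addr0 ract_linear ra0 addr0.
Qed.

Lemma ractZl a c x : ract (c *: a : A) x = c *: ract a x.
Proof. by rewrite -[c *: a]addr0 ract_linearl ract0l addr0. Qed.

Lemma ractD a x y : ract (a : A) (x + y) = ract a x + ract a y.
Proof. by rewrite -[x]scale1r ract_linear !scale1r. Qed.

Lemma ractB a x y : ract (a : A) (x - y) = ract a x - ract a y.
Proof. by rewrite ractD -scaleN1r ractZ scaleN1r. Qed.

Lemma starKinv i : star (UKinv U i) = UKinv U i.
Proof.
have [KV VK sK _ _ _ _ _ _ _] := Uq_rel U.
have s1 : star 1 = 1 :> U.
  by rewrite -[LHS]mulr1 -[X in _ * X]starK -starM mulr1 starK.
have e : star (UKinv U i) * UK U i = 1 by rewrite -[X in _ * X]sK -starM KV s1.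
by rewrite -[LHS]mulr1 -(KV i) mulrA e mul1r.
Qed.

Lemma starF i : star (UF U i) = UE U i.
Proof. by rewrite -(rel_starE (Uq_rel U)) starK. Qed.

Lemma in_L0P (a : A) : in_L 0 a <->
  [/\ ract a K1 = a, ract a E1 = 0, ract a F1 = 0 & ract a (K2 ^+ 2) = a].
Proof.
have [KV VK _ _ _ _ _ _ _ _] := Uq_rel U.
have in_gen x : x \in [:: K1; K1inv; E1; F1] -> Uq_su2 x.
  by move=> ?; apply: gen_in.
rewrite /in_L expr0z scale1r; split=> [[aS aK]|[aK aE aF aKK]].
  have aK1 : ract a K1 = a.
    by rewrite aS ?UcounitK ?scale1r //; apply: in_gen; rewrite inE eqxx.
  split=> //.
  - rewrite aS ?UcounitE ?scale0r //; apply: in_gen.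
    by rewrite !inE eqxx !orbT.
  - rewrite aS ?UcounitF ?scale0r //; apply: in_gen.
    by rewrite !inE eqxx !orbT.
  - by rewrite -[RHS]aK ractM aK1.
split; last by rewrite ractM aK.
move=> x; elim=> {x} [x|||].
- rewrite !inE => /or4P[] /eqP->.
  + by rewrite UcounitK scale1r.
  + rewrite -[X in ract X _]aK -ractM KV ract1.
    suff -> : counit (Uq_hopf U) K1inv = 1 by rewrite scale1r.
    have := congr1 (counit (Uq_hopf U)) (KV 0).
    by rewrite rmorphM rmorph1 /= UcounitK mul1r.
  + by rewrite UcounitE scale0r.
  + by rewrite UcounitF scale0r.
- by rewrite ract1 rmorph1 scale1r.
- by move=> c x y _ IHx _ IHy; rewrite ract_linear IHx IHy linearP scalerDl scalerA.
- move=> x y _ IHx _ IHy; rewrite ractM IHx ractZl IHy rmorphM scalerA.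
  by [].
Qed.

Lemma CP2P (a : A) : reflect
  [/\ ract a K1 = a, ract a E1 = 0, ract a F1 = 0 & ract a (K2 ^+ 2) = a]
  (a \in CP2_pred).
Proof. by apply: (iffP (asboolP _)) => /in_L0P. Qed.

Lemma CP2_closed : subalg_closed CP2_pred.
Proof.
split=> [|c a b /CP2P[aK aE aF aKK] /CP2P[bK bE bF bKK]|
         a b /CP2P[aK aE aF aKK] /CP2P[bK bE bF bKK]];
  apply/CP2P; split.
- by rewrite ract_one UcounitK scale1r.
- by rewrite ract_one UcounitE scale0r.
- by rewrite ract_one UcounitF scale0r.
- by rewrite expr2 ractM !ract_one ractZl !UcounitK ract_one UcounitK !scale1r.
- by rewrite ract_linearl aK bK.
- by rewrite ract_linearl aE bE scaler0 addr0.
- by rewrite ract_linearl aF bF scaler0 addr0.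
- by rewrite ract_linearl aKK bKK.
- by rewrite ractMK aK bK.
- by rewrite ractME aE bE mul0r mulr0 addr0.
- by rewrite ractMF aF bF mul0r mulr0 addr0.
- by rewrite expr2 ractM !ractMK -!ractM -!expr2 aKK bKK.
Qed.

HB.instance Definition _ :=
  GRing.isSubalgClosed.Build C A CP2_pred (GRing.subalg_closed_semi CP2_closed).
HB.instance Definition _ := [SubChoice_isSubAlgebra of CP2 by <:].

Lemma CP2_star (a : A) : a \in CP2_pred -> star a \in CP2_pred.
Proof.
have VK := rel_KinvK (Uq_rel U).
have star0 : star (0 : A) = 0.
  by have := star_linear (-1) (0 : A) 0; rewrite scaler0 addr0 rmorphN1 scaleN1r addNr.
have starZ c (x : U) : star (c *: x) = c^* *: star x.
  have star0U : star (0 : U) = 0.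
    by have := star_linear (-1) (0 : U) 0; rewrite scaler0 addr0 rmorphN1 scaleN1r addNr.
  by rewrite -[c *: x]addr0 star_linear star0U addr0.
have q_neq0 : q != 0.
  by rewrite gt_eqF //; case/andP: q01.
move=> /CP2P[aK aE aF aKK]; apply/CP2P; split.
- have : star a = ract (star a) K1inv.
    by rewrite -{1}aK ract_star UantipodeK starKinv.
  by move=> e; rewrite {1}e -ractM VK ract1.
- have := ract_star F1 a.
  rewrite aF star0 UantipodeF starZ starF ractZ => /esym/eqP.
  by rewrite scaler_eq0 fmorph_eq0 oppr_eq0 invr_eq0 (negPf q_neq0) => /eqP.
- have := ract_star E1 a.
  rewrite aE star0 UantipodeE starZ (rel_starE (Uq_rel U)) ractZ => /esym/eqP.
  by rewrite scaler_eq0 fmorph_eq0 oppr_eq0 (negPf q_neq0) => /eqP.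
- have : star a = ract (star a) (K2inv ^+ 2).
    by rewrite -{1}aKK !expr2 !ractM !ract_star UantipodeK starKinv.
  move=> e; rewrite {1}e -ractM; suff -> : K2inv ^+ 2 * K2 ^+ 2 = 1 by rewrite ract1.
  by rewrite !expr2 -mulrA (mulrA K2inv K2) VK mul1r VK.
Qed.

Definition CP2_starfun (a : CP2) : CP2 := CP2Build (CP2_star (valP a)).

Lemma CP2_starK : involutive CP2_starfun.
Proof. by move=> a; apply: val_inj; rewrite /= starK. Qed.

Lemma CP2_star_linear (c : C) x y :
  CP2_starfun (c *: x + y) = c^* *: CP2_starfun x + CP2_starfun y.
Proof. by apply: val_inj; rewrite /= star_linear. Qed.

Lemma CP2_starM x y : CP2_starfun (x * y) = CP2_starfun y * CP2_starfun x.
Proof. by apply: val_inj; rewrite /= starM. Qed.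

HB.instance Definition _ :=
  isStarAlgebra.Build C CP2 CP2_starK CP2_star_linear CP2_starM.

Lemma CP2_sigma (a : A) : a \in CP2_pred -> lact modular_elt a \in CP2_pred.
Proof.
have l0 : lact modular_elt (0 : A) = 0.
  have := lact_linear modular_elt (-1) (0 : A) 0.
  by rewrite scaler0 addr0 scaleN1r addNr.
move=> /CP2P[aK aE aF aKK]; apply/CP2P.
by split; rewrite lract ?aK ?aE ?aF ?aKK.
Qed.

(* On CP2 the right action of modular_elt is trivial, so that sigma is the
   restriction of modular_aut. *)
Definition sigma (a : CP2) : CP2 := CP2Build (CP2_sigma (valP a)).

Definition pair_act (v : A * A) (x : U) : A * A := (ract v.1 x, ract v.2 x).

(* Pairs v = (v_+, v_-) with (v_+, v_-) <| K1 K2^2 = q^{e/2} (v_+, v_-): the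
   (1,0)-forms for e = -3, the (0,1)-forms for e = 3. *)
Definition form_pred (e : int) : {pred A * A} := fun v =>
  `[< [/\ pair_act v K1 = (qpow q 1 *: v.1, qpow q (-1) *: v.2),
          pair_act v F1 = (0, v.1),
          pair_act v E1 = (v.2, 0) &
          pair_act v (K1 * K2 ^+ 2) = qpow q e *: v] >].

Record vform (e : int) := Form { form_val :> A * A; formP : form_pred e form_val }.
HB.instance Definition _ e := [isSub for @form_val e].
HB.instance Definition _ e := [Choice of vform e by <:].

Lemma form_closed e : submod_closed (form_pred e).
Proof.
split=> [|c v w /asboolP[]]; first apply/asboolP.
  by rewrite /pair_act /= !ract0l !scaler0; split.
case: v w => [v1 v2] [w1 w2]; rewrite /pair_act /= => -[vK vK'] [vF vF'] [vE vE'] [vL vL'].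
move=> /asboolP[]; rewrite /pair_act /=.
move=> [wK wK'] [wF wF'] [wE wE'] [wL wL']; apply/asboolP.
rewrite /pair_act /= !ract_linearl vK vK' vF vF' vE vE' vL vL'.
rewrite wK wK' wF wF' wE wE' wL wL'.
have sc (x y : A) d : c *: (d *: x) + d *: y = d *: (c *: x + y).
  by rewrite scalerDr !scalerA mulrC.
by rewrite !sc !scaler0 !addr0; split.
Qed.

HB.instance Definition _ e := GRing.isSubmodClosed.Build C (A * A)%type
  (form_pred e) (GRing.submod_closed_semi (form_closed e)).
HB.instance Definition _ e := [SubChoice_isSubLmodule of vform e by <:].


Lemma formP_intro e (v : A * A) :
  ract v.1 K1 = qpow q 1 *: v.1 -> ract v.2 K1 = qpow q (-1) *: v.2 ->
  ract v.1 F1 = 0 -> ract v.2 F1 = v.1 ->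
  ract v.1 E1 = v.2 -> ract v.2 E1 = 0 ->
  ract v.1 (K1 * K2 ^+ 2) = qpow q e *: v.1 ->
  ract v.2 (K1 * K2 ^+ 2) = qpow q e *: v.2 -> form_pred e v.
Proof.
case: v => v1 v2 /= h1 h2 h3 h4 h5 h6 h7 h8; apply/asboolP.
by rewrite /pair_act /= h1 h2 h3 h4 h5 h6 h7 h8.
Qed.

Lemma formP_elim e (v : A * A) : form_pred e v ->
  [/\ ract v.1 K1 = qpow q 1 *: v.1 /\ ract v.2 K1 = qpow q (-1) *: v.2,
      ract v.1 F1 = 0 /\ ract v.2 F1 = v.1,
      ract v.1 E1 = v.2 /\ ract v.2 E1 = 0 &
      ract v.1 (K1 * K2 ^+ 2) = qpow q e *: v.1 /\
      ract v.2 (K1 * K2 ^+ 2) = qpow q e *: v.2].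
Proof.
by case: v => v1 v2 /asboolP[]; rewrite /pair_act /= => -[-> ->] [-> ->] [-> ->] [-> ->].
Qed.

Lemma ractMKK a b : ract (a * b : A) (K1 * K2 ^+ 2) =
  ract a (K1 * K2 ^+ 2) * ract b (K1 * K2 ^+ 2).
Proof. by rewrite expr2 !ractM !ractMK. Qed.

Lemma CP2_ractKinv (a : A) : ract a K1 = a -> ract a K1inv = a.
Proof. by move=> e; rewrite -{1}e -ractM (rel_KKinv (Uq_rel U)) ract1. Qed.

Lemma CP2_ractKK (a : CP2) : ract (val a) (K1 * K2 ^+ 2) = val a.
Proof. by case/CP2P: (valP a) => aK _ _ aKK; rewrite ractM aK. Qed.

Lemma lmul_subproof e (a : CP2) (v : vform e) :
  form_pred e (val a * (val v).1, val a * (val v).2).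
Proof.
have /formP_elim[[k1 k2] [f1 f2] [e1 e2] [l1 l2]] := formP v.
have /CP2P[aK aE aF _] := valP a; have aKi := CP2_ractKinv aK.
apply: formP_intro => /=.
- by rewrite ractMK aK k1 scalerAr.
- by rewrite ractMK aK k2 scalerAr.
- by rewrite ractMF aF f1 mul0r mulr0 addr0.
- by rewrite ractMF aF aKi f2 mul0r add0r.
- by rewrite ractME aE aKi e1 mul0r add0r.
- by rewrite ractME aE e2 mul0r mulr0 addr0.
- by rewrite ractMKK CP2_ractKK l1 scalerAr.
- by rewrite ractMKK CP2_ractKK l2 scalerAr.
Qed.

Lemma rmul_subproof e (v : vform e) (a : CP2) :
  form_pred e ((val v).1 * val a, (val v).2 * val a).
Proof.
have /formP_elim[[k1 k2] [f1 f2] [e1 e2] [l1 l2]] := formP v.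
have /CP2P[aK aE aF _] := valP a; have aKi := CP2_ractKinv aK.
apply: formP_intro => /=.
- by rewrite ractMK aK k1 scalerAl.
- by rewrite ractMK aK k2 scalerAl.
- by rewrite ractMF aF f1 mul0r mulr0 addr0.
- by rewrite ractMF aF aK f2 mulr0 addr0.
- by rewrite ractME aE aK e1 mulr0 addr0.
- by rewrite ractME aE e2 mul0r mulr0 addr0.
- by rewrite ractMKK CP2_ractKK l1 scalerAl.
- by rewrite ractMKK CP2_ractKK l2 scalerAl.
Qed.

Definition lmul e (a : CP2) (v : vform e) : vform e := Form (lmul_subproof a v).
Definition rmul e (v : vform e) (a : CP2) : vform e := Form (rmul_subproof v a).

Lemma q_facts : [/\ 0 < q, q != 0, q - q^-1 != 0 & sqrtC q != 0].
Proof.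
have /andP[q0 q1] := q01.
have qn0 : q != 0 by rewrite gt_eqF.
split=> //; last by rewrite sqrtC_eq0.
rewrite subr_eq0; apply/eqP => e.
have : q * q = 1 by rewrite {2}e mulfV.
by apply/eqP; rewrite lt_eqF // -expr2 expr_lt1 // ltW.
Qed.

Lemma qpowD k l : qpow q k * qpow q l = qpow q (k + l).
Proof. by have [_ _ _ s0] := q_facts; rewrite /qpow expfzDr. Qed.

Lemma qpow2 : qpow q 2 = q. Proof. exact: sqrtCK. Qed.

Lemma qpow0 : qpow q 0 = 1. Proof. by []. Qed.

Lemma qpowN k : (qpow q k)^-1 = qpow q (- k).
Proof. by rewrite /qpow invr_expz. Qed.

Lemma swap12 (x y : U) k : x * y = qpow q k *: (y * x) ->
  y * x = qpow q (- k) *: (x * y).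
Proof. by move=> ->; rewrite scalerA qpowD addNr scale1r. Qed.

Lemma starZU c (x : U) : star (c *: x) = c^* *: star x.
Proof.
have star0 : star (0 : U) = 0.
  have := star_linear (-1) (0 : U) 0.
  by rewrite scaler0 addr0 rmorphN1 scaleN1r addNr.
by rewrite -[c *: x]addr0 star_linear star0 addr0.
Qed.

Lemma starDU (x y : U) : star (x + y) = star x + star y.
Proof. by rewrite -[x]scale1r star_linear rmorph1 !scale1r. Qed.

Lemma qpow_conj k : (qpow q k)^* = qpow q k.
Proof.
have [q0 _ _ _] := q_facts.
by rewrite /qpow fmorphXz /= geC0_conj // sqrtC_ge0 ltW.
Qed.

Lemma UEK i : UE U i * UK U i = qpow q (-2) *: (UK U i * UE U i).
Proof. by apply/(@swap12 _ _ 2); rewrite qpow2; apply: (rel_KE (Uq_rel U)). Qed.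

Lemma UEKne i j : i != j -> UE U j * UK U i = qpow q 1 *: (UK U i * UE U j).
Proof. by move=> ij; apply/(@swap12 _ _ (-1))/(rel_KEne (Uq_rel U)). Qed.

Lemma UFK i : UF U i * UK U i = qpow q 2 *: (UK U i * UF U i).
Proof.
have /(congr1 star) : UK U i * UE U i = qpow q 2 *: (UE U i * UK U i).
  by rewrite qpow2; apply: (rel_KE (Uq_rel U)).
rewrite starZU qpow_conj !starM (rel_starE (Uq_rel U)).
by rewrite (rel_starK (Uq_rel U)).
Qed.

Lemma UFKne i j : i != j -> UF U j * UK U i = qpow q (-1) *: (UK U i * UF U j).
Proof.
move=> /(rel_KEne (Uq_rel U))/(congr1 star).
rewrite starZU qpow_conj !starM (rel_starE (Uq_rel U)).
by rewrite (rel_starK (Uq_rel U)).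
Qed.

Lemma UEF_swap i j : i != j -> UE U i * UF U j = UF U j * UE U i.
Proof. by move=> /(rel_EFne (Uq_rel U)) /subr0_eq. Qed.

Lemma USerreF i j : i != j -> UF U j * UF U i ^+ 2 + UF U i ^+ 2 * UF U j =
  (q + q^-1) *: (UF U i * UF U j * UF U i).
Proof.
have qJ : q^* = q by have := qpow_conj 2; rewrite qpow2.
move=> /(rel_Serre (Uq_rel U))/(congr1 star).
rewrite starDU starZU !expr2 !starM !(rel_starE (Uq_rel U)) -!mulrA => ->.
by rewrite rmorphD /= fmorphV /= qJ.
Qed.

Lemma ract_twist (a : A) x y k c : x * y = qpow q k *: (y * x) ->
  ract a y = c *: a -> ract (ract a x) y = (qpow q k * c) *: ract a x.
Proof. by move=> xy ay; rewrite -ractM xy ractZ ractM ay ractZl scalerA. Qed.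

Lemma ract_L i k1 k2 x (a : A) :
  x * K1 = qpow q k1 *: (K1 * x) -> x * K2 = qpow q k2 *: (K2 * x) ->
  ract a (K1 * K2 ^+ 2) = qpow q i *: a ->
  ract (ract a x) (K1 * K2 ^+ 2) = qpow q (k1 + k2 + k2 + i) *: ract a x.
Proof.
move=> xK1 xK2 aL; rewrite -(qpowD _ i); apply: ract_twist aL.
rewrite mulrA xK1 expr2 -scalerAl -!mulrA (mulrA x) xK2.
rewrite -scalerAl -(mulrA K2) xK2 -!scalerAr !scalerA !qpowD.
by rewrite addrA.
Qed.

Lemma ract_K1inv (a : A) c : c != 0 -> ract a K1 = c *: a ->
  ract a K1inv = c^-1 *: a.
Proof.
move=> c0 e; have := congr1 (fun b => c^-1 *: ract b K1inv) e.
by rewrite /= -ractM (rel_KKinv (Uq_rel U)) ract1 ractZl scalerA mulVf // scale1r.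
Qed.

Lemma ract_EF (a : A) k : ract a K1 = qpow q k *: a ->
  ract a (E1 * F1 - F1 * E1) =
  ((q - q^-1)^-1 * (qpow q (k + k) - qpow q (- k - k))) *: a.
Proof.
have [_ _ _ s0] := q_facts.
move=> aK; have aKi : ract a K1inv = qpow q (- k) *: a.
  by rewrite -qpowN; apply: ract_K1inv => //; rewrite expfz_neq0.
rewrite (rel_EF (Uq_rel U)) ractZ ractB !expr2 !ractM aK aKi !ractZl aK aKi.
by rewrite !scalerA !qpowD -scalerBl scalerA.
Qed.

Lemma ract_EF1 (a : A) : ract a K1 = qpow q 1 *: a ->
  ract a (E1 * F1 - F1 * E1) = a.
Proof.
have [_ _ qq _] := q_facts; have qm2 : qpow q (-2) = q^-1 by rewrite -qpowN qpow2.
move=> /ract_EF ->; rewrite -[1 + 1]/(2%:Z) -[- 1 - 1]/(- 2%:Z) qpow2 qm2.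
by rewrite mulVf // scale1r.
Qed.

Lemma ract_EFN1 (a : A) : ract a K1 = qpow q (-1) *: a ->
  ract a (E1 * F1 - F1 * E1) = - a.
Proof.
have [_ _ qq _] := q_facts; have qm2 : qpow q (-2) = q^-1 by rewrite -qpowN qpow2.
move=> /ract_EF ->; rewrite -[-1 + -1]/(- 2%:Z) -[- -1 - -1]/(2%:Z) qpow2 qm2.
by rewrite -(opprB q) mulrN mulVf // scaleN1r.
Qed.

Lemma partial_subproof (a : CP2) :
  form_pred (-3) (ract (val a) E2, ract (val a) (E2 * E1)).
Proof.
have /CP2P[aK aE aF aKK] := valP a.
have aL : ract (val a) (K1 * K2 ^+ 2) = qpow q 0 *: val a.
  by rewrite CP2_ractKK scale1r.
have vK : ract (ract (val a) E2) K1 = qpow q 1 *: ract (val a) E2.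
  by rewrite (ract_twist (c := 1) (UEKne _)) ?mulr1 ?scale1r.
have vF : ract (ract (val a) E2) F1 = 0.
  by rewrite -ractM UEF_swap // ractM aF ract0l.
apply: formP_intro => //=.
- by rewrite (ractM E2) (ract_twist (UEK _) vK) qpowD.
- have := ract_EF1 vK; rewrite ractB (ractM F1) vF ract0l subr0 => e.
  by rewrite -ractM -mulrA ractM e.
- by rewrite ractM.
- have := rel_Serre (Uq_rel U) (isT : (0 : 'I_2) != 1) => /(congr1 (ract (val a))).
  rewrite ractD ractZ expr2 -!mulrA !(ractM E1) aE !ract0l scaler0 add0r.
  by rewrite !mulrA !ractM.
- by rewrite (ract_L (UEKne _) (UEK _) aL).
- by rewrite (ractM E2) (ract_L (UEK _) (UEKne _) (ract_L (UEKne _) (UEK _) aL)).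
Qed.

Lemma partialbar_subproof (a : CP2) :
  form_pred 3 (ract (val a) (F2 * F1), ract (val a) F2).
Proof.
have /CP2P[aK aE aF aKK] := valP a.
have aL : ract (val a) (K1 * K2 ^+ 2) = qpow q 0 *: val a.
  by rewrite CP2_ractKK scale1r.
have vK : ract (ract (val a) F2) K1 = qpow q (-1) *: ract (val a) F2.
  by rewrite (ract_twist (c := 1) (UFKne _)) ?mulr1 ?scale1r.
have vE : ract (ract (val a) F2) E1 = 0.
  by rewrite -ractM -UEF_swap // ractM aE ract0l.
apply: formP_intro => //=.
- by rewrite (ractM F2) (ract_twist (UFK _) vK) qpowD.
- have := USerreF (isT : (0 : 'I_2) != 1) => /(congr1 (ract (val a))).
  rewrite ractD ractZ expr2 -!mulrA !(ractM F1) aF !ract0l scaler0 addr0.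
  by rewrite !mulrA !ractM.
- by rewrite ractM.
- have := ract_EFN1 vK; rewrite ractB (ractM E1) vE ract0l sub0r => /oppr_inj e.
  by rewrite -ractM -mulrA ractM e.
- by rewrite (ractM F2) (ract_L (UFK _) (UFKne _) (ract_L (UFKne _) (UFK _) aL)).
- by rewrite (ract_L (UFKne _) (UFK _) aL).
Qed.

(* a |-> (a <| E2, a <| E2 E1) and a |-> (a <| F2 F1, a <| F2) *)
Definition partial_form (a : CP2) : vform (-3) := Form (partial_subproof a).
Definition partialbar_form (a : CP2) : vform 3 := Form (partialbar_subproof a).

Definition wedge (v w : A * A) : A :=
  qpow q 1 *: (v.1 * w.2) - qpow q (-1) *: (v.2 * w.1).

Local Notation oneform := (vform (-3) * vform 3)%type.

Section Calculus.
(* The constants with which the explicit formulas for the two components of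
   the differential are normalized. *)
Variables (c cbar : C).

Definition diff (a : CP2) : oneform :=
  (c *: partial_form a, cbar *: partialbar_form a).

(* An algebra map f on A together with an A-bimodule map g on Omega^1 = (1,0)
   + (0,1), i.e. an algebra map on the tensor algebra of the bimodule Omega^1,
   that kills the defining ideal of the maximal prolongation. *)
Record prolongation_data (B : algType C) (f : {lrmorphism CP2 -> B})
    (g : {linear oneform -> B}) : Prop := {
  prolong_lmul : forall a v, g (lmul a v.1, lmul a v.2) = f a * g v;
  prolong_rmul : forall a v, g (rmul v.1 a, rmul v.2 a) = g v * f a;
  prolong_ideal : forall s : seq (CP2 * CP2),
    \sum_(p <- s) (lmul p.1 (diff p.2).1, lmul p.1 (diff p.2).2) = 0
      :> oneform ->
    \sum_(p <- s) g (diff p.1) * g (diff p.2) = 0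
}.

Record max_prolongation := MaxProlongation {
  Omega :> algType C;
  incl : {lrmorphism CP2 -> Omega};
  jmap : {linear oneform -> Omega};
  Omega_data : prolongation_data incl jmap;
  Omega_universal : forall (B : algType C) (f : {lrmorphism CP2 -> B})
    (g : {linear oneform -> B}), prolongation_data f g ->
    let good (k : {lrmorphism Omega -> B}) :=
      (forall a, k (incl a) = f a) /\ (forall v, k (jmap v) = g v) in
    exists k : {lrmorphism Omega -> B},
      good k /\ forall k' : {lrmorphism Omega -> B}, good k' -> k' =1 k
}.

Variable Om : max_prolongation.

Definition partial (a : CP2) : Om := jmap Om (c *: partial_form a, 0).
Definition partialbar (a : CP2) : Om := jmap Om (0, cbar *: partialbar_form a).

Inductive bidegree : nat -> nat -> Om -> Prop :=
| bidegree_iota a : bidegree 0 0 (incl Om a)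
| bidegree_10 v : bidegree 1 0 (jmap Om (v, 0))
| bidegree_01 v : bidegree 0 1 (jmap Om (0, v))
| bidegree_add m n x y of bidegree m n x & bidegree m n y :
    bidegree m n (x + y)
| bidegree_mul m n m' n' x y of bidegree m n x & bidegree m' n' y :
    bidegree (m + m') (n + n') (x * y).

Record central_basis (w : Om) : Prop := {
  basis_bidegree : bidegree 2 2 w;
  basis_free : forall x, bidegree 2 2 x -> exists! a, x = incl Om a * w;
  basis_central : forall a, w * incl Om a = incl Om a * w
}.

(* The left-hand sides involve the differentials of the calculus, with their
   constants c, cbar, the right-hand sides the explicit formulas for the pairs. *)
Record normalized (w : Om) (kappa1 kappa2 : C) : Prop := {
  normalized1 : forall a1 a2 a3 a4, exists2 x : CP2,
    val x = kappa1 *: (wedge (val (partial_form a1)) (val (partial_form a2)) *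
              wedge (val (partialbar_form a3)) (val (partialbar_form a4))) &
    partial a1 * partial a2 * partialbar a3 * partialbar a4 = incl Om x * w;
  normalized2 : forall a1 a2 a3 a4, exists2 x : CP2,
    val x = kappa2 *: (wedge (val (partialbar_form a1)) (val (partialbar_form a2)) *
              wedge (val (partial_form a3)) (val (partial_form a4))) &
    partialbar a1 * partialbar a2 * partial a3 * partial a4 = incl Om x * w
}.

Variables (h : {linear A -> C^o}) (w : Om).

(* Meaningful on forms of bidegree (2,2) when w is a basis element. *)
Definition integral (x : Om) : C :=
  h (val (xget 0 [set a : CP2 | x = incl Om a * w]%classic)).

Definition phi1 (a : 5.-tuple CP2) : C^o := - 3%:R *
  integral (incl Om a`_0 * partial a`_1 * partial a`_2 *
            partialbar a`_3 * partialbar a`_4).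

Definition phi2 (a : 5.-tuple CP2) : C^o := - 3%:R *
  integral (incl Om a`_0 * partialbar a`_1 * partialbar a`_2 *
            partial a`_3 * partial a`_4).

Definition phi (a : 5.-tuple CP2) : C^o := phi1 a + phi2 a.

End Calculus.

End CP2.

(* Main.v *)
Require Import Defs.
From HB Require Import structures.
From mathcomp Require Import all_boot all_order all_algebra.
From mathcomp Require Import complex reals boolp classical_sets ring.

Set Implicit Arguments.
Unset Strict Implicit.
Unset Printing Implicit Defensive.

Import Order.TTheory GRing.Theory Num.Theory.
Local Open Scope ring_scope.

(* Since [w] is central, [phi] reduces to functionals on [A(SU_q(3))] of the form
   [k h(a0 (D1 a1 ^ D1 a2) (D2 a3 ^ D2 a4))], with {D1, D2} the holomorphic and
   antiholomorphic derivations. The Leibniz rule makes the Hochschild coboundary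
   telescope, up to one commutator that the modular property of the Haar state
   cancels. For positivity, [D2 (b2^* ) ^ D2 (b1^* )] is a negative multiple of
   [(D1 b1 ^ D1 b2)^* ], so that, [k] being negative, the form is a positive
   multiple of [h(X Y^* )] with [X = a0 (D1 a1 ^ D1 a2)].

   The Leibniz rule needs [K2] to act trivially on CP2, whereas the definition
   only gives this for [K2^2]: [A(SU_q(3))] is generated by the [u i j], hence
   spanned by eigenvectors of [K2] with positive eigenvalues. *)

(** * Elementary rules for the star operation *)

Section StarAlgebraTheory.
Variables (C : numClosedFieldType) (A : starAlgType C).
Implicit Types x y : A.

Lemma star0 : star (0 : A) = 0.
Proof.
have := star_linear (-1) (0 : A) 0.
by rewrite scaler0 addr0 rmorphN1 scaleN1r addNr.
Qed.

Lemma starD x y : star (x + y) = star x + star y.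
Proof. by rewrite -[x]scale1r star_linear rmorph1 !scale1r. Qed.

Lemma starZ c x : star (c *: x) = c^* *: star x.
Proof. by rewrite -[c *: x]addr0 star_linear star0 addr0. Qed.

Lemma star1 : star 1 = 1 :> A.
Proof. by rewrite -[LHS]mulr1 -[X in _ * X]starK -starM mulr1 starK. Qed.

Lemma starB x y : star (x - y) = star x - star y.
Proof. by rewrite starD -scaleN1r starZ rmorphN1 scaleN1r. Qed.

Lemma star_sum (I : Type) (r : seq I) (F : I -> A) :
  star (\sum_(i <- r) F i) = \sum_(i <- r) star (F i).
Proof. exact: (big_morph _ starD star0). Qed.

End StarAlgebraTheory.

(** * Generation of [A] by the matrix entries [u A i j] *)

Section Generation.
Variables (C : numClosedFieldType) (q : C) (q01 : 0 < q < 1).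
Variables (U : Uq_su3 q01) (A : SUq3 U).

Definition generated : A -> Prop :=
  gen_subalgebra (fun x => exists i j, x = u A i j).

Definition generated_pred : {pred A} := fun a => `[< generated a >].

(** The universal property of [A] only concerns star algebras, so the subalgebra has to be made into
    one. *)
Record generated_alg :=
  GeneratedAlg { generated_val :> A; generated_valP : generated_pred generated_val }.
HB.instance Definition _ := [isSub for generated_val].
HB.instance Definition _ := [Choice of generated_alg by <:].

Lemma generated_closed : subalg_closed generated_pred.
Proof.
split=> [|c a b /asboolP ga /asboolP gb|a b /asboolP ga /asboolP gb]; apply/asboolP.
- exact: gen_one.
- exact: gen_linear.
- exact: gen_mul.
Qed.

HB.instance Definition _ := GRing.isSubalgClosed.Build C A generated_pred
  (GRing.subalg_closed_semi generated_closed).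
HB.instance Definition _ := [SubChoice_isSubAlgebra of generated_alg by <:].

Lemma generated_u i j : u A i j \in generated_pred.
Proof. by apply/asboolP/gen_in; exists i, j. Qed.

(** The star of a generator is a quadratic polynomial in the generators. *)
Lemma generated_star (a : A) : a \in generated_pred -> star a \in generated_pred.
Proof.
move=> /asboolP; elim=> {a} [_ [i [j ->]]||c x y _ sx _ sy|x y _ sx _ sy].
- rewrite (rel_star (SUq3_rel A)) rpredZ // rpredB ?rpredZ // rpredM //;
    exact: generated_u.
- by rewrite star1 rpred1.
- by rewrite star_linear rpredD ?rpredZ.
- by rewrite starM rpredM.
Qed.

Definition generated_starfun (a : generated_alg) : generated_alg :=
  GeneratedAlg (generated_star (generated_valP a)).

Lemma generated_starK : involutive generated_starfun.
Proof. by move=> a; apply: val_inj; rewrite /= starK. Qed.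

Lemma generated_star_linear (c : C) x y :
  generated_starfun (c *: x + y) = c^* *: generated_starfun x + generated_starfun y.
Proof. by apply: val_inj; rewrite /= star_linear. Qed.

Lemma generated_starM x y :
  generated_starfun (x * y) = generated_starfun y * generated_starfun x.
Proof. by apply: val_inj; rewrite /= starM. Qed.

HB.instance Definition _ := isStarAlgebra.Build C generated_alg
  generated_starK generated_star_linear generated_starM.

Lemma generated_val_linear : linear generated_val. Proof. by []. Qed.

Lemma generated_val_monoid : monoid_morphism generated_val. Proof. by []. Qed.

HB.instance Definition _ :=
  GRing.isLinear.Build C generated_alg A *:%R generated_val generated_val_linear.
HB.instance Definition _ :=
  GRing.isMonoidMorphism.Build generated_alg A generated_val generated_val_monoid.

Definition gen_u i j : generated_alg := GeneratedAlg (generated_u i j).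

Lemma gen_u_relations : SUq3_relations q gen_u.
Proof.
have [col row com cross det str] := SUq3_rel A.
split.
- by move=> i j k ij; apply: val_inj; rewrite /= col.
- by move=> i j k ij; apply: val_inj; rewrite /= row.
- by move=> i j k l ij kl; apply: val_inj; rewrite /= com.
- by move=> i j k l ij kl; apply: val_inj; rewrite /= cross.
- apply: val_inj; rewrite raddf_sum /= -[RHS]det.
  by apply: eq_bigr => s _.
- by move=> i j; apply: val_inj; rewrite /= str.
Qed.

(* The universal property factors the identity through the subalgebra. *)
Lemma SUq3_generated (a : A) : generated a.
Proof.
have [f [[f_star f_u] _]] := SUq3_universal A gen_u_relations.
have [g [_ g_uniq]] := SUq3_universal A (SUq3_rel A).
pose vf : {lrmorphism A -> A} := generated_val \o f.
have vfg : vf =1 g.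
  apply: g_uniq; split=> [x|i j]; first by rewrite /= f_star.
  by rewrite /= f_u.
have idg : (idfun : {lrmorphism A -> A}) =1 g by apply: g_uniq; split.
have -> : a = val (f a) by rewrite -[LHS]/(idfun a) idg -vfg.
by apply/asboolP; apply: generated_valP.
Qed.

End Generation.

(** * Positivity of the weights of [UK], and its trivial action on [CP2] *)

Section K2Weights.
Variables (C : numClosedFieldType) (q : C) (q01 : 0 < q < 1).
Variables (U : Uq_su3 q01) (A : SUq3 U).
Implicit Types a b x y : A.

Lemma ractDl a b (x : U) : ract (a + b) x = ract a x + ract b x.
Proof. by rewrite -[a]scale1r ract_linearl !scale1r. Qed.

Lemma ractNl a (x : U) : ract (- a) x = - ract a x.
Proof. by rewrite -!scaleN1r ractZl. Qed.

Lemma ractBl a b (x : U) : ract (a - b) x = ract a x - ract b x.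
Proof. by rewrite ractDl ractNl. Qed.

Lemma qpow_gt0 k : 0 < qpow q k.
Proof. by rewrite exprz_gt0 // sqrtC_gt0; case/andP: q01. Qed.

Definition positive_weight (k : U) (p : C * A) : Prop :=
  0 < p.1 /\ ract p.2 k = p.1 *: p.2.

(** Eigenvalues may repeat: only their positivity matters, not a direct sum decomposition. *)
Definition weight_sum (k : U) a : Prop := exists2 s : seq (C * A),
  {in s, forall p, positive_weight k p} & a = \sum_(p <- s) p.2.

(** [UK U i] is group-like, so eigenvectors multiply to eigenvectors and eigenvalues multiply; on
    generators these are powers of the square root of [q]. *)
Lemma weight_sum_K i a : weight_sum (UK U i) a.
Proof.
elim: (SUq3_generated a) => {a} [_ [j [k ->]]||c x y _ [s sw ->] _ [t tw ->]
  |x y _ [s sw ->] _ [t tw ->]].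
- exists [:: (qpow q ((hi i == j)%:Z - (lo i == j)%:Z), u A j k)].
    by move=> p; rewrite inE => /eqP->; split; rewrite ?qpow_gt0 ?ractK.
  by rewrite big_seq1.
- exists [:: (1, 1)]; last by rewrite big_seq1.
  move=> p; rewrite inE => /eqP->; split; first exact: ltr01.
  by rewrite /= ract_one UcounitK.
- exists ([seq (p.1, c *: p.2) | p <- s] ++ t); last first.
    by rewrite big_cat big_map /= scaler_sumr.
  move=> p; rewrite mem_cat => /orP[/mapP[r /sw[r0 rK] ->]|/tw//].
  by split=> //=; rewrite ractZl rK !scalerA mulrC.
- exists [seq (p.1 * r.1, p.2 * r.2) | p <- s, r <- t]; last first.
    by rewrite big_allpairs_dep /= mulr_suml; apply: eq_bigr => p _; rewrite mulr_sumr.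
  move=> _ /allpairsP[[p r] /= [/sw[p0 pK] /tw[r0 rK] ->]].
  split; first exact: mulr_gt0.
  by rewrite /= ractMK pK rK -scalerAl -scalerAr scalerA.
Qed.

Lemma weight_sum_no_opp (k : U) a : weight_sum k a -> ract a k = - a -> a = 0.
Proof.
(* The induction is on the length of the sum, because its terms get rescaled when one of them is
   removed. *)
move=> [s]; have [n] := ubnP (size s).
elim: n s a => [//|n IHn] [|p s] a /= sn sw; first by rewrite big_nil.
rewrite big_cons => aE ak.
have [p0 pk] : positive_weight k p by apply: sw; rewrite inE eqxx.
have nz : - (p.1 + 1) != 0 by rewrite oppr_eq0 gt_eqF // addr_gt0 ?ltr01.
suff : - (p.1 + 1) *: a = 0.
  by move/eqP; rewrite scaler_eq0 (negPf nz) => /eqP.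
have e : ract a k - p.1 *: a = - (p.1 + 1) *: a.
  by rewrite ak scaleNr scalerDl scale1r opprD addrC.
(* Applying [k - p.1] multiplies [a] by [-1 - p.1] and kills the term [p]. *)
pose shift (r : C * A) := (r.1, (r.1 - p.1) *: r.2).
have sw' : {in s, forall r, positive_weight k r}.
  by move=> r rs; apply: sw; rewrite inE rs orbT.
have se : ract a k - p.1 *: a = \sum_(r <- map shift s) r.2.
  rewrite aE ractDl pk scalerDr opprD addrACA subrr add0r big_map /=.
  elim: s sw' {sn sw aE} => [|r s IHs] sw'.
    by rewrite !big_nil ract0l scaler0 subrr.
  rewrite !big_cons -IHs; last by move=> t ts; apply: sw'; rewrite inE ts orbT.
  have [_ rk] := sw' r (mem_head _ _).
  by rewrite ractDl rk scalerDr opprD addrACA scalerBl.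
rewrite -e; apply: (IHn (map shift s)) => //; first by rewrite size_map.
  2: by rewrite e ractZl ak scalerN.
move=> _ /mapP[r /sw'[r0 rk] ->]; split=> //=.
by rewrite ractZl rk !scalerA mulrC.
Qed.

(* [a <| K2 - a] is an eigenvector of [K2] for the eigenvalue -1. *)
Lemma CP2_ractK2 (a : CP2 A) : ract (val a) (UK U 1) = val a.
Proof.
have /CP2P[_ _ _ aKK] := valP a; set b := ract _ _.
apply/eqP; rewrite -subr_eq0; apply/eqP.
apply: (@weight_sum_no_opp (UK U 1)); first exact: weight_sum_K.
by rewrite ractBl -ractM -expr2 aKK opprB.
Qed.

Lemma CP2_ractK i (a : CP2 A) : ract (val a) (UK U i) = val a.
Proof.
by case: i => -[|[|//]] i_lt; [have /CP2P[+ _ _ _] := valP a|have := CP2_ractK2 a];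
  congr (ract _ _ = _); congr (UK _ _); apply: val_inj.
Qed.

Lemma CP2_ractKi i (a : CP2 A) : ract (val a) (UKinv U i) = val a.
Proof. by rewrite -{1}(CP2_ractK i a) -ractM (rel_KKinv (Uq_rel U)) ract1. Qed.

End K2Weights.

(** * The modular automorphism and its left half *)

Section Modular.
Variables (C : numClosedFieldType) (q : C) (q01 : 0 < q < 1).
Variables (U : Uq_su3 q01) (A : SUq3 U).

Lemma CP2_modular (a : CP2 A) : modular_aut (val a) = val (sigma a).
Proof.
rewrite /modular_aut -/(val (sigma a)) /modular_elt.
have e : ract (val (sigma a)) (UKinv U 1 * UKinv U 0) = val (sigma a).
  by rewrite ractM !CP2_ractKi.
by rewrite /= in e *; rewrite !exprS expr0 mulr1 !(ractM (_ * _ : U)) !e.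
Qed.

Lemma lactMK i (a b : A) : lact (UK U i) (a * b) = lact (UK U i) a * lact (UK U i) b.
Proof.
(* [UcomulK] is an equality of tensors, so it applies only through a multilinear map. *)
pose F (p : 2.-tuple U) : A := lact p`_0 a * lact p`_1 b.
have F_mul : multilinear F.
  move=> p j c y z; rewrite /F /= !(enum_ordSl, enum_ord0) /=.
  case: j => -[|[|//]] j_lt /=; rewrite lact_linearl.
    by rewrite mulrDl -scalerAl.
  by rewrite mulrDr -scalerAr.
by rewrite lact_mul (UcomulK i F_mul) big_seq1.
Qed.

Lemma lact_KinvK i (a : A) : lact (UKinv U i) (lact (UK U i) a) = a.
Proof. by rewrite -lactM (rel_KinvK (Uq_rel U)) lact1. Qed.

Lemma lact_KKinv i (a : A) : lact (UK U i) (lact (UKinv U i) a) = a.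
Proof. by rewrite -lactM (rel_KKinv (Uq_rel U)) lact1. Qed.

(** The inverse of a multiplicative bijection is multiplicative. *)
Lemma lactMKinv i (a b : A) :
  lact (UKinv U i) (a * b) = lact (UKinv U i) a * lact (UKinv U i) b.
Proof.
by rewrite -{1}(lact_KKinv i a) -{1}(lact_KKinv i b) -lactMK lact_KinvK.
Qed.

(** This extends [sigma] to all of [A], where the components of forms live. *)
Definition lmod (a : A) : A := lact (modular_elt U) a.

Lemma lmodE (a : A) : lmod a = iter 4 (fun x => lact (UKinv U 1) (lact (UKinv U 0) x)) a.
Proof. by rewrite /lmod /modular_elt !exprS expr0 mulr1 !lactM. Qed.

Lemma lmodM (a b : A) : lmod (a * b) = lmod a * lmod b.
Proof. by rewrite !lmodE /= !lactMKinv. Qed.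

Lemma lmod_linear : linear lmod. Proof. exact: lact_linear. Qed.

End Modular.

(** * Sums of cocycles, and the cyclic operator in degree 4 *)

Section Cochains.
Variables (C : numClosedFieldType) (B : starAlgType C) (s : B -> B).

Lemma multilinearD (V : lmodType C) n (f g : n.-tuple B -> V) :
  multilinear f -> multilinear g -> multilinear (fun t => f t + g t).
Proof. by move=> fl gl t i k x y; rewrite fl gl scalerDr addrACA. Qed.

Lemma iter_cyclic_opD n m (f g : n.+1.-tuple B -> C^o) a :
  iter m (@cyclic_op C B s n) (fun t => f t + g t) a =
  iter m (@cyclic_op C B s n) f a + iter m (@cyclic_op C B s n) g a.
Proof.
by elim: m a => [//|m IHm] a /=; rewrite /cyclic_op IHm mulrDr.
Qed.

Lemma hochschild_cocycleD n (f g : n.+1.-tuple B -> C^o) :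
  hochschild_cocycle s f -> hochschild_cocycle s g ->
  hochschild_cocycle s (fun t => f t + g t).
Proof.
move=> [[fl fc] fb] [[gl gc] gb]; split; first split.
- exact: multilinearD.
- by move=> a; rewrite iter_cyclic_opD fc gc.
move=> a; rewrite /hochschild_b mulrDr.
under eq_bigr do rewrite mulrDr.
by rewrite big_split addrACA [X in X + _]fb [X in _ + X]gb addr0.
Qed.

Lemma twisted_positiveD n (f g : n.*2.+1.-tuple B -> C^o) :
  twisted_positive s f -> twisted_positive s g ->
  twisted_positive s (fun t => f t + g t).
Proof.
move=> fp gp r; under eq_bigr do rewrite big_split.
by rewrite big_split addr_ge0 ?fp ?gp.
Qed.

(** Five rotations restore the order and send each argument through [s] once, with sign
    [(-1) ^+ 4 = 1] each time. The cyclic condition thus becomes invariance under [s]. *)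
Lemma iter5_cyclic_op (f : 5.-tuple B -> C^o) a :
  iter 5 (@cyclic_op C B s 4) f a = f [tuple of map s a].
Proof.
rewrite /= /cyclic_op !(exprS, expr0, mulr1, mulrN1, opprK, mul1r, mulN1r).
congr f; apply: val_inj; rewrite /= !(enum_ordSl, enum_ord0) /=.
by case: a => -[|a0 [|a1 [|a2 [|a3 [|a4 [|]]]]]].
Qed.

End Cochains.

(** * The functional attached to a pair of derivations: cocycle property and positivity *)

Section FormFunctional.
Variables (C : numClosedFieldType) (q : C) (q01 : 0 < q < 1).
Variables (U : Uq_su3 q01) (A : SUq3 U).
Variables (h : {linear A -> C^o}) (h_haar : haar_state h).
Implicit Types v w : A * A.

Lemma haarP (c : C) (x y : A) : h (c *: x + y) = c * h x + h y :> C.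
Proof. by rewrite linearP. Qed.

Lemma wedge_linearl w : linear (fun v => wedge v w).
Proof.
move=> k v v'; rewrite /wedge /= !mulrDl -!scalerAl !scalerDr scalerN opprD addrACA.
by rewrite !scalerA !(mulrC k).
Qed.

Lemma wedge_linearr v : linear (wedge v : A * A -> A).
Proof.
move=> k w w'; rewrite /wedge /= !mulrDr -!scalerAr !scalerDr scalerN opprD addrACA.
by rewrite !scalerA !(mulrC k).
Qed.

Lemma wedge_mull a v w : wedge (a * v.1, a * v.2) w = a * wedge v w.
Proof. by rewrite /wedge /= mulrBr -!scalerAr !mulrA. Qed.

Lemma wedge_mulr a v w : wedge v (w.1 * a, w.2 * a) = wedge v w * a.
Proof. by rewrite /wedge /= mulrBl -!scalerAl !mulrA. Qed.

(** This is the balancing over [A] that lets the Leibniz terms of neighboring faces match. *)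
Lemma wedge_balanced a v w : wedge (v.1 * a, v.2 * a) w = wedge v (a * w.1, a * w.2).
Proof. by rewrite /wedge /= !mulrA. Qed.

Lemma wedge_lmod v w :
  wedge (lmod v.1, lmod v.2) (lmod w.1, lmod w.2) = lmod (wedge v w).
Proof.
have lmodD k (x y : A) : lmod (k *: x + y) = k *: lmod x + lmod y.
  exact: lmod_linear.
rewrite /wedge /= -!scaleNr lmodD -[_ *: (v.2 * w.1)]addr0 lmodD.
have -> : lmod (0 : A) = 0.
  by have := lmodD (-1) 0 0; rewrite scaler0 addr0 scaleN1r addNr.
by rewrite !lmodM addr0.
Qed.

(** These are the properties shared by the holomorphic and antiholomorphic differentials, so that
    [phi1] and [phi2] differ only by exchanging [D1] and [D2]. *)
Record covariant_derivation (D : CP2 A -> A * A) : Prop := {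
  deriv_linear : linear D;
  derivM : forall a b, D (a * b) =
    ((D a).1 * val b, (D a).2 * val b) + (val a * (D b).1, val a * (D b).2);
  deriv_sigma : forall a, D (sigma a) = (lmod (D a).1, lmod (D a).2)
}.

Variables (D1 D2 : CP2 A -> A * A) (k : C).
Hypotheses (D1P : covariant_derivation D1) (D2P : covariant_derivation D2).

Definition form_functional (a : 5.-tuple (CP2 A)) : C^o :=
  k * h (val a`_0 * (wedge (D1 a`_1) (D1 a`_2) * wedge (D2 a`_3) (D2 a`_4))).

Lemma wedge_derivMl D (DP : covariant_derivation D) a b w :
  wedge (D (a * b)) w = wedge (D a) (val b * w.1, val b * w.2) + val a * wedge (D b) w.
Proof.
rewrite (derivM DP) -[X in X + _]scale1r wedge_linearl scale1r.
by rewrite wedge_balanced wedge_mull.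
Qed.

Lemma wedge_derivMr D (DP : covariant_derivation D) a b v :
  wedge v (D (a * b)) = wedge v (D a) * val b + wedge v (val a * (D b).1, val a * (D b).2).
Proof.
by rewrite (derivM DP) -[X in X + _]scale1r wedge_linearr scale1r wedge_mulr.
Qed.

Lemma form_functional_multilinear : multilinear form_functional.
Proof.
move=> t i c x y; rewrite /form_functional /= !(enum_ordSl, enum_ord0) /=.
have hl X Y : c *: (k * h X : C^o) + k * h Y = k * h (c *: X + Y).
  by rewrite haarP mulrDr (mulrCA k).
have mul_l (a b z z' : A) : a * ((c *: z + z') * b) = c *: (a * (z * b)) + a * (z' * b).
  by rewrite mulrDl mulrDr -scalerAl -scalerAr.
have mul_r (a b z z' : A) : a * (b * (c *: z + z')) = c *: (a * (b * z)) + a * (b * z').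
  by rewrite mulrDr mulrDr -!scalerAr.
case: i => -[|[|[|[|[|//]]]]] i_lt; rewrite /= hl; congr (k * h _).
- by rewrite mulrDl -scalerAl.
- by rewrite (deriv_linear D1P) wedge_linearl mul_l.
- by rewrite (deriv_linear D1P) wedge_linearr mul_l.
- by rewrite (deriv_linear D2P) wedge_linearl mul_r.
- by rewrite (deriv_linear D2P) wedge_linearr mul_r.
Qed.

Lemma haar_twist (x : A) (a : CP2 A) : h (val (sigma a) * x) = h (x * val a).
Proof. by rewrite -CP2_modular -(haar_modular h_haar). Qed.

Lemma haar_sigma (a : CP2 A) : h (val (sigma a)) = h (val a).
Proof. by rewrite -[LHS](congr1 h (mulr1 _)) haar_twist mul1r. Qed.

Lemma form_functional_b a : hochschild_b (@sigma _ _ _ _ A) form_functional a = 0.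
Proof.
rewrite /hochschild_b !big_ord_recl big_ord0 /form_functional /=.
rewrite !(enum_ordSl, enum_ord0) /=.
set a0 := a`_0; set a1 := a`_1; set a2 := a`_2; set a3 := a`_3.
set a4 := a`_4; set a5 := a`_5.
have hD X Y : h (X + Y) = h X + h Y :> C by rewrite linearD.
have hD2 (X Y Z Z' : A) : h (X * (Y * (Z + Z'))) = h (X * (Y * Z)) + h (X * (Y * Z')) :> C.
  by rewrite !mulrDr hD.
pose W b1 b2 b3 b4 := wedge (D1 b1) (D1 b2) * wedge (D2 b3) (D2 b4).
pose lm (b : CP2 A) (v : A * A) := (val b * v.1, val b * v.2).
(* In [Q], [R] and [S] the undifferentiated factor is [a2], [a3] and [a4] respectively; each occurs
   in two consecutive faces, with opposite signs. The term with [a1] undifferentiated cancels the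
   face [a0 * a1], and the one with [a5] undifferentiated cancels the twisted face by
   [haar_twist]. *)
pose Q := h (val a0 * (wedge (D1 a1) (lm a2 (D1 a3)) * wedge (D2 a4) (D2 a5))) : C.
pose R := h (val a0 * (wedge (D1 a1) (D1 a2) * val a3 * wedge (D2 a4) (D2 a5))) : C.
pose S := h (val a0 * (wedge (D1 a1) (D1 a2) * wedge (D2 a3) (lm a4 (D2 a5)))) : C.
have e1 : h (val a0 * W (a1 * a2) a3 a4 a5) = Q + h (val a0 * val a1 * W a2 a3 a4 a5) :> C.
  by rewrite /W wedge_derivMl // mulrDl mulrDr hD /Q !mulrA.
have e2 : h (val a0 * W a1 (a2 * a3) a4 a5) = R + Q :> C.
  by rewrite /W wedge_derivMr // mulrDl mulrDr hD.
have e3 : h (val a0 * W a1 a2 (a3 * a4) a5) = S + R :> C.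
  by rewrite /W wedge_derivMl // hD2 /R /S !mulrA.
have e4 : h (val a0 * W a1 a2 a3 (a4 * a5)) = h (val a0 * W a1 a2 a3 a4 * val a5) + S :> C.
  by rewrite /W wedge_derivMr // hD2 /S !mulrA.
have e5 : h (val (sigma a5) * val a0 * W a1 a2 a3 a4) = h (val a0 * W a1 a2 a3 a4 * val a5) :> C.
  by rewrite -mulrA haar_twist.
have -> : lact (modular_elt U) a5 = val (sigma a5) by [].
rewrite -/(W _ _ _ _) -!/(W _ _ _ _).
rewrite e1 e2 e3 e4 e5.
by rewrite /bump /=; ring.
Qed.

(** By [iter5_cyclic_op], cyclicity is invariance of [h] under [sigma]. As [haar_sigma] concerns
    [CP2], the products of wedges are required to lie there. *)
Lemma form_functional_cocycle :
  (forall a1 a2 a3 a4, wedge (D1 a1) (D1 a2) * wedge (D2 a3) (D2 a4) \in @CP2_pred _ _ _ _ A) ->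
  hochschild_cocycle (@sigma _ _ _ _ A) form_functional.
Proof.
move=> W_CP2; split; last exact: form_functional_b.
split=> [|a]; first exact: form_functional_multilinear.
rewrite iter5_cyclic_op /form_functional.
case: a => -[|a0 [|a1 [|a2 [|a3 [|a4 [|]]]]]] // a_size /=.
rewrite !(deriv_sigma D1P, deriv_sigma D2P) !wedge_lmod -!lmodM.
by have := haar_sigma (a0 * CP2Build (W_CP2 a1 a2 a3 a4)) => /= <-.
Qed.

Variables (x y : C).
Hypothesis D2_star : forall b,
  D2 (star b) = (x *: star (D1 b).2, y *: star (D1 b).1).

(** [D2_star] swaps components while [star] swaps factors, so each product keeps its coefficient, a
    real power of the square root of [q]. *)
Lemma wedge_star a b : wedge (D2 (star a)) (D2 (star b)) =
  (x * y) *: star (wedge (D1 b) (D1 a)).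
Proof.
rewrite !D2_star /wedge /= starB !starZ !starM !qpow_conj // scalerBr.
by rewrite -!scalerAl -!scalerAr !scalerA; congr (_ *: _ - _ *: _); ring.
Qed.

(** By [haar_twist], [sigma (star b0)] moves to the far right, where it completes the starred wedge
    to [star (X b)]. *)
Lemma form_functional_positive : 0 <= k * (x * y) ->
  twisted_positive (n:=2) (@sigma _ _ _ _ A) form_functional.
Proof.
move=> kxy_ge0 s.
pose X (a : 3.-tuple (CP2 A)) := val a`_0 * wedge (D1 a`_1) (D1 a`_2).
have formE (a b : 3.-tuple (CP2 A)) :
    twisted_form (n:=2) (@sigma _ _ _ _ A) form_functional a b =
    k * (x * y) * h (X a * star (X b)).
  rewrite /twisted_form /form_functional /= !(enum_ordSl, enum_ord0) /=.
  have -> : lact (modular_elt U) (star (val b`_0)) = val (sigma (star b`_0)) by [].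
  rewrite wedge_star -(mulrA (val _)) haar_twist // -!scalerAr -scalerAl.
  by rewrite -[_ *: _]addr0 haarP linear0 addr0 !mulrA /X starM !mulrA.
under eq_bigr do under eq_bigr do rewrite formE.
(* Sesquilinearity in [X] collapses the double sum; the double star gives it the shape of
   [haar_ge0]. *)
have -> : \sum_(a <- s) \sum_(b <- s) k * (x * y) * h (X a * star (X b)) =
    k * (x * y) * h (star (star (\sum_(a <- s) X a)) * star (\sum_(a <- s) X a)).
  rewrite starK star_sum mulr_suml linear_sum /= mulr_sumr.
  apply: eq_bigr => a _; rewrite mulr_sumr linear_sum mulr_sumr.
  by apply: eq_bigr.
by rewrite mulr_ge0 // (haar_ge0 h_haar).
Qed.

End FormFunctional.

(** * The two differentials as derivations exchanged by the star *)

Section PartialDerivations.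
Variables (C : numClosedFieldType) (q : C) (q01 : 0 < q < 1).
Variables (U : Uq_su3 q01) (A : SUq3 U).

Lemma q_conj : q^* = q.
Proof. by rewrite -(qpow2 q) qpow_conj. Qed.

(** The coproduct of [UE U 1] gives a Leibniz rule twisted by [UK U 1] and [UKinv U 1], both of
    which act trivially on [CP2]. *)
Lemma ractMCP2_E2 (a b : CP2 A) : ract (val a * val b) (UE U 1) =
  ract (val a) (UE U 1) * val b + val a * ract (val b) (UE U 1).
Proof. by rewrite ractME CP2_ractK CP2_ractKi. Qed.

Lemma ractMCP2_F2 (a b : CP2 A) : ract (val a * val b) (UF U 1) =
  ract (val a) (UF U 1) * val b + val a * ract (val b) (UF U 1).
Proof. by rewrite ractMF CP2_ractK CP2_ractKi. Qed.

Lemma partial_derivation :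
  covariant_derivation (fun a : CP2 A => val (partial_form a)).
Proof.
split=> [c a b|a b|a]; first by rewrite /= !ract_linearl.
- congr pair; rewrite /= ?ractM ractMCP2_E2 //.
  (* In the second component, the further action of [UE U 0] kills [a] and [b], which leaves the
     terms where it hits a derivative. *)
  have /CP2P[_ aE _ _] := valP a; have /CP2P[_ bE _ _] := valP b.
  rewrite ractDl !ractME aE bE CP2_ractK CP2_ractKi.
  by rewrite mulr0 mul0r addr0 add0r.
- by rewrite /= !lract.
Qed.

Lemma partialbar_derivation :
  covariant_derivation (fun a : CP2 A => val (partialbar_form a)).
Proof.
split=> [c a b|a b|a]; first by rewrite /= !ract_linearl.
- congr pair; rewrite /= ?ractM ractMCP2_F2 //.
  have /CP2P[_ _ aF _] := valP a; have /CP2P[_ _ bF _] := valP b.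
  rewrite ractDl !ractMF aF bF CP2_ractK CP2_ractKi.
  by rewrite mulr0 mul0r addr0 add0r.
- by rewrite /= !lract.
Qed.

Lemma ract_starF i (a : A) :
  ract (star a) (UF U i) = - q^-1 *: star (ract a (UE U i)).
Proof.
have [_ q0 _ _] := q_facts q01.
rewrite ract_star UantipodeE starZ (rel_starE (Uq_rel U)) ractZ rmorphN /= q_conj.
by rewrite scalerA mulrNN mulVf // scale1r.
Qed.

Lemma ract_starE i (a : A) :
  ract (star a) (UE U i) = - q *: star (ract a (UF U i)).
Proof.
have [_ q0 _ _] := q_facts q01.
rewrite ract_star UantipodeF starZ starF ractZ rmorphN fmorphV /= q_conj.
by rewrite scalerA mulrNN mulfV // scale1r.
Qed.

(** Each generator carried across the star costs [- q^-1]. With three in all, the two constants have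
    a negative product. *)
Lemma partialbar_star (a : CP2 A) : val (partialbar_form (star a)) =
  (q^-2 *: star (val (partial_form a)).2, - q^-1 *: star (val (partial_form a)).1).
Proof.
congr pair; rewrite /= ?ractM ract_starF // ractZl ract_starF scalerA mulrNN.
by rewrite -invfM -expr2.
Qed.

Lemma partial_star (a : CP2 A) : val (partial_form (star a)) =
  (- q *: star (val (partialbar_form a)).2, q ^+ 2 *: star (val (partialbar_form a)).1).
Proof.
by congr pair; rewrite /= ?ractM ract_starE // ractZl ract_starE scalerA mulrNN.
Qed.

End PartialDerivations.

(** * Reduction of the integrals to the Haar state *)

Section Integral.
Variables (C : numClosedFieldType) (q : C) (q01 : 0 < q < 1).
Variables (U : Uq_su3 q01) (A : SUq3 U).
Variables (h : {linear A -> C^o}) (c cbar : C) (Om : max_prolongation A c cbar).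
Variables (w : Om) (w_basis : central_basis w).
Variables (kappa1 kappa2 : C) (w_normalized : normalized w kappa1 kappa2).

(** Freeness leaves [xget] a single possible value. *)
Lemma integral_basis a : integral h w (incl Om a * w) = h (val a).
Proof.
have aw_deg : bidegree 2 2 (incl Om a * w).
  exact: (bidegree_mul (bidegree_iota _ a) (basis_bidegree w_basis)).
have [b [_ b_uniq]] := Defs.basis_free w_basis aw_deg.
rewrite /integral (@xget_unique _ _ _ a) // => b' /b_uniq <-.
by rewrite (b_uniq a).
Qed.

Lemma phi1E a : phi1 h w a = form_functional h
  (fun a => val (partial_form a)) (fun a => val (partialbar_form a)) (- 3%:R * kappa1) a.
Proof.
have [x xE] := normalized1 w_normalized a`_1 a`_2 a`_3 a`_4.
rewrite /phi1 -!mulrA => ->; rewrite mulrA -rmorphM integral_basis.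
rewrite /form_functional -mulrA; congr (_ * _).
by rewrite [val (_ * _)]/= xE -scalerAr -[_ *: _]addr0 haarP linear0 addr0.
Qed.

Lemma phi2E a : phi2 h w a = form_functional h
  (fun a => val (partialbar_form a)) (fun a => val (partial_form a)) (- 3%:R * kappa2) a.
Proof.
have [x xE] := normalized2 w_normalized a`_1 a`_2 a`_3 a`_4.
rewrite /phi2 -!mulrA => ->; rewrite mulrA -rmorphM integral_basis.
rewrite /form_functional -mulrA; congr (_ * _).
by rewrite [val (_ * _)]/= xE -scalerAr -[_ *: _]addr0 haarP linear0 addr0.
Qed.

Lemma phiE : phi h w = fun a : 5.-tuple (CP2 A) =>
  form_functional h (fun a => val (partial_form a))
    (fun a => val (partialbar_form a)) (- 3%:R * kappa1) a +
  form_functional h (fun a => val (partialbar_form a))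
    (fun a => val (partial_form a)) (- 3%:R * kappa2) a.
Proof. by apply/funext => a; rewrite /phi phi1E phi2E. Qed.

End Integral.

(** [normalized] places only [kappa] times a product of wedges in [CP2]; dividing by [kappa] gives
    what [form_functional_cocycle] asks for. *)
Lemma CP2_scale_inv (C : numClosedFieldType) (q : C) (q01 : 0 < q < 1)
    (U : Uq_su3 q01) (A : SUq3 U) (x : A) (y : CP2 A) (k : C) :
  k != 0 -> val y = k *: x -> x \in @CP2_pred _ _ _ _ A.
Proof.
move=> k0 yE; have -> : x = val (k^-1 *: y) by rewrite /= yE scalerA mulVf // scale1r.
exact: CP2_valP.
Qed.

Theorem proposition6p1 (R : realType) (q : R[i]) (q01 : 0 < q < 1)
  (U : Uq_su3 q01) (A : SUq3 U)
  (h : {linear A -> R[i]^o}) (h_haar : haar_state h)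
  (c cbar : R[i]) (c_neq0 : c != 0) (cbar_neq0 : cbar != 0)
  (Om : max_prolongation A c cbar) (w : Om) (w_basis : central_basis w)
  (kappa1 kappa2 : R[i]) (kappa1_gt0 : 0 < kappa1) (kappa2_gt0 : 0 < kappa2)
  (w_normalized : normalized w kappa1 kappa2) :
  @twisted_positive_cocycle _ (CP2 A) (@sigma _ _ _ _ A) 2 (phi h w).
Proof.
have [q0 _ _ _] := q_facts q01.
have dP := partial_derivation A; have dbP := partialbar_derivation A.
have W1 a1 a2 a3 a4 :=
  let: ex_intro2 x xE _ := normalized1 w_normalized a1 a2 a3 a4 in
  CP2_scale_inv (lt0r_neq0 kappa1_gt0) xE.
have W2 a1 a2 a3 a4 :=
  let: ex_intro2 x xE _ := normalized2 w_normalized a1 a2 a3 a4 in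
  CP2_scale_inv (lt0r_neq0 kappa2_gt0) xE.
rewrite (phiE h w_basis w_normalized); split.
  by apply: hochschild_cocycleD; apply: form_functional_cocycle.
apply: (twisted_positiveD (n:=2)).
(* The signs cancel: [k * (x * y)] equals [3 * kappa1 * q^-3] here, and [3 * kappa2 * q^3] in the
   next case. *)
- apply: (form_functional_positive h_haar (partialbar_star (A:=A))).
  by rewrite !mulrN !mulNr opprK !mulr_ge0 ?invr_ge0 ?exprn_ge0 ?ltW ?ltr0n.
- apply: (form_functional_positive h_haar (partial_star (A:=A))).
  by rewrite !mulNr mulrN opprK !mulr_ge0 ?exprn_ge0 ?ltW ?ltr0n.
Qed.
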